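(* Each of the set-valued permutation statistics $\operatorname{Des}$ (descent set), $\operatorname{Pk}$ (peak set), $\operatorname{Lpk}$ (left peak set), $\operatorname{Rpk}$ (right peak set), and $\operatorname{Epk}$ (exterior peak set) is shuffle compatible.
   Context: For a finite set $U$ of positive integers, a permutation of $U$ is a linear order $\pi=\pi_1\pi_2\cdots\pi_m$ of all the elements of $U$ (each appearing exactly once); write $\operatorname{dom}(\pi)=U$, $|\pi|=|U|=m$, and let $L(U)$ be the set of permutations of $U$. Two permutations $\pi\in L(U)$, $\pi'\in L(V)$ with $|U|=|V|$ have the same relative order if applying the unique strictly increasing bijection $U\to V$ to the entries of $\pi$ gives $\pi'$. A permutation statistic is a map $\operatorname{St}$ defined on all permutations of all finite sets of positive integers such that $\operatorname{St}(\pi)=\operatorname{St}(\pi')$ whenever $\pi$ and $\pi'$ have the same relative order. For permutations $\pi,\sigma$ with disjoint domains, the shuffle set $\operatorname{Sh}(\pi,\sigma)$ is the set of all $\tau\in L(\operatorname{dom}(\pi)\sqcup\operatorname{dom}(\sigma))$ containing both $\pi$ and $\sigma$ as (not necessarily contiguous) subwords. For a set $\Pi$ of permutations, $\operatorname{St}(\Pi)$ denotes the multiset $\{\{\operatorname{St}(\pi) : \pi\in\Pi\}\}$. A permutation statistic $\operatorname{St}$ is shuffle compatible if for all permutations $\pi,\pi',\sigma,\sigma'$ with $|\pi|=|\pi'|$, $|\sigma|=|\sigma'|$, $\operatorname{dom}(\pi)\cap\operatorname{dom}(\sigma)=\operatorname{dom}(\pi')\cap\operatorname{dom}(\sigma')=\emptyset$,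 $\operatorname{St}(\pi)=\operatorname{St}(\pi')$ and $\operatorname{St}(\sigma)=\operatorname{St}(\sigma')$, one has the equality of multisets $\operatorname{St}(\operatorname{Sh}(\pi,\sigma))=\operatorname{St}(\operatorname{Sh}(\pi',\sigma'))$. For $\pi=\pi_1\cdots\pi_m$: $\operatorname{Des}(\pi)=\{i\in[m-1] : \pi_i>\pi_{i+1}\}$; $\operatorname{Pk}(\pi)=\{i : 2\le i\le m-1,\ \pi_{i-1}<\pi_i>\pi_{i+1}\}$. Put $\pi_0=0$ and $\pi_{m+1}=0$ (an added $0$ at position $0$ and an added $0$ at position $m+1$). Then $\operatorname{Lpk}(\pi)$ is the set of peaks of $0\pi$, i.e. $\{i : 1\le i\le m-1,\ \pi_{i-1}<\pi_i>\pi_{i+1}\}$; $\operatorname{Rpk}(\pi)$ is the set of peaks of $\pi0$, i.e. $\{i : 2\le i\le m,\ \pi_{i-1}<\pi_i>\pi_{i+1}\}$; and $\operatorname{Epk}(\pi)$ is the set of peaks of $0\pi0$, i.e. $\{i : 1\le i\le m,\ \pi_{i-1}<\pi_i>\pi_{i+1}\}$. *)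

(* Defs.v *)
From HB Require Import structures.
From mathcomp Require Import all_boot.
From mathcomp Require Import finmap multiset.

Set Implicit Arguments.
Unset Strict Implicit.
Unset Printing Implicit Defensive.

Local Open Scope mset_scope.
Local Open Scope fset_scope.
Local Open Scope nat_scope.

Record permutation := Permutation {
  word :> seq nat;
  _ : uniq word && all (leq 1) word
}.

HB.instance Definition _ := [isSub for word].
HB.instance Definition _ := [Choice of permutation by <:].

Lemma perm_uniq_word (p : permutation) : uniq p.
Proof. by case: p => w /= /andP[]. Qed.

Lemma perm_pos_word (p : permutation) x : x \in (p : seq nat) -> 0 < x.
Proof. by case: p => w /= /andP[_ /allP]; apply. Qed.

Definition dom (p : permutation) : {fset nat} := [fset x in (p : seq nat)].

(* If 0 \in U this is empty, since [insub] discards words with a zero entry. *)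
Definition perms_of (U : {fset nat}) : {fset permutation} :=
  [fset p in pmap insub (permutations U)].

Lemma mem_perms_of U p : (p \in perms_of U) = (dom p == U).
Proof.
rewrite /perms_of in_fset /= mem_pmap_sub /= mem_permutations.
apply/idP/eqP => [pU|<-].
  by apply/fsetP => x; rewrite in_fset /= (perm_mem pU).
apply: uniq_perm; [exact: perm_uniq_word | exact: fset_uniq | ].
by move=> x; rewrite in_fset.
Qed.

Definition Sh (p s : permutation) : {fset permutation} :=
  [fset t in perms_of (dom p `|` dom s) | subseq p t && subseq s t].

(* Clauses 1 and 2 say that f restricts to a strictly increasing bijection
   from dom p to dom s; its values elsewhere are irrelevant. *)
Definition same_relative_order (p s : permutation) : Prop :=
  exists f : nat -> nat,
    [/\ {in dom p &, {homo f : x y / x < y}},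
        [fset f x | x in dom p] = dom s
      & map f p = s].

Record statistic (K : choiceType) := Statistic {
  stat_fun :> permutation -> K;
  _ : forall p s, same_relative_order p s -> stat_fun p = stat_fun s
}.

Definition stat_multiset (K : choiceType) (St : statistic K)
    (P : {fset permutation}) : {mset K} :=
  seq_mset [seq St p | p <- P].

Definition shuffle_compatible (K : choiceType) (St : statistic K) : Prop :=
  forall p p' s s' : permutation,
    size p = size p' -> size s = size s' ->
    dom p `&` dom s = fset0 -> dom p' `&` dom s' = fset0 ->
    St p = St p' -> St s = St s' ->
    stat_multiset St (Sh p s) = stat_multiset St (Sh p' s').

(* One-based i-th letter, with letter 0 at position 0 and (via the default
   value of [nth]) at all positions beyond the length of p. *)
Definition letter (p : permutation) (i : nat) : nat := nth 0 (0 :: word p) i.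

Definition peak_at (p : permutation) (i : nat) : bool :=
  (letter p i.-1 < letter p i) && (letter p i.+1 < letter p i).

(* [index_iota a b] enumerates a, ..., b - 1. *)
Definition des_set (p : permutation) : {fset nat} :=
  [fset i in index_iota 1 (size p) | letter p i.+1 < letter p i].
Definition pk_set (p : permutation) : {fset nat} :=
  [fset i in index_iota 2 (size p) | peak_at p i].
Definition lpk_set (p : permutation) : {fset nat} :=
  [fset i in index_iota 1 (size p) | peak_at p i].
Definition rpk_set (p : permutation) : {fset nat} :=
  [fset i in index_iota 2 (size p).+1 | peak_at p i].
Definition epk_set (p : permutation) : {fset nat} :=
  [fset i in index_iota 1 (size p).+1 | peak_at p i].

Lemma same_relative_order_size (p s : permutation) :
  same_relative_order p s -> size p = size s.
Proof. by case=> f [_ _ <-]; rewrite size_map. Qed.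

Lemma letter_out (p : permutation) i : size p < i -> letter p i = 0.
Proof. by move=> lt_pi; rewrite /letter nth_default. Qed.

Lemma letter_pos (p : permutation) i : 0 < i <= size p -> 0 < letter p i.
Proof.
case: i => // i /andP[_ lt_ip]; rewrite /letter /=.
exact/(@perm_pos_word p)/mem_nth.
Qed.

Lemma same_relative_order_ltn p s i j : same_relative_order p s ->
  (letter p i < letter p j) = (letter s i < letter s j).
Proof.
move=> ps; have sz := same_relative_order_size ps.
have zero (q : permutation) k : ~~ (0 < k <= size q) -> letter q k = 0.
  by case: k => // k; rewrite -ltnNge; apply: letter_out.
case ri: (0 < i <= size p); last first.
  rewrite zero ?ri // [letter s i]zero -?sz ?ri //.
  case rj: (0 < j <= size p); first by rewrite !letter_pos -?sz.
  by rewrite zero ?rj // [letter s j]zero -?sz ?rj.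
case rj: (0 < j <= size p); last first.
  by rewrite [letter p j]zero ?rj // [letter s j]zero -?sz ?rj.
case: ps => f [f_incr _ fps].
case: i ri => // i ri; case: j rj => // j rj; rewrite /letter -fps /=.
rewrite !(nth_map 0) //.
have xd : nth 0 p i \in dom p by rewrite in_fset /= mem_nth.
have yd : nth 0 p j \in dom p by rewrite in_fset /= mem_nth.
case: (ltngtP (nth 0 p i) (nth 0 p j)) => [lt_xy|lt_yx|->].
- by rewrite f_incr.
- by apply/esym/negbTE; rewrite -leqNgt ltnW ?f_incr.
- by rewrite ltnn.
Qed.

Lemma same_relative_order_peak p s i : same_relative_order p s ->
  peak_at p i = peak_at s i.
Proof. by move=> ps; rewrite /peak_at !(same_relative_order_ltn _ _ ps). Qed.

Lemma same_relative_order_des p s : same_relative_order p s -> des_set p = des_set s.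
Proof.
move=> ps; apply/fsetP => i; rewrite !inE /= (same_relative_order_size ps).
by rewrite (same_relative_order_ltn _ _ ps).
Qed.

Lemma same_relative_order_pk p s : same_relative_order p s -> pk_set p = pk_set s.
Proof.
move=> ps; apply/fsetP => i; rewrite !inE /= (same_relative_order_size ps).
by rewrite (same_relative_order_peak _ ps).
Qed.

Lemma same_relative_order_lpk p s : same_relative_order p s -> lpk_set p = lpk_set s.
Proof.
move=> ps; apply/fsetP => i; rewrite !inE /= (same_relative_order_size ps).
by rewrite (same_relative_order_peak _ ps).
Qed.

Lemma same_relative_order_rpk p s : same_relative_order p s -> rpk_set p = rpk_set s.
Proof.
move=> ps; apply/fsetP => i; rewrite !inE /= (same_relative_order_size ps).
by rewrite (same_relative_order_peak _ ps).
Qed.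

Lemma same_relative_order_epk p s : same_relative_order p s -> epk_set p = epk_set s.
Proof.
move=> ps; apply/fsetP => i; rewrite !inE /= (same_relative_order_size ps).
by rewrite (same_relative_order_peak _ ps).
Qed.

Definition Des : statistic {fset nat} := Statistic same_relative_order_des.
Definition Pk : statistic {fset nat} := Statistic same_relative_order_pk.
Definition Lpk : statistic {fset nat} := Statistic same_relative_order_lpk.
Definition Rpk : statistic {fset nat} := Statistic same_relative_order_rpk.
Definition Epk : statistic {fset nat} := Statistic same_relative_order_epk.

(* Main.v *)
Require Import Defs.
From mathcomp Require Import all_boot.
From mathcomp Require Import finmap multiset.
From mathcomp Require Import zify.

Set Implicit Arguments.
Unset Strict Implicit.
Unset Printing Implicit Defensive.

Local Open Scope nat_scope.

(** The descent set and the four peak sets are instances of one construction.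
Record, for each letter of a word, whether it is marked: the top of a descent
when descents are wanted, a peak when peaks are wanted, where the word may be
preceded and/or followed by a 0. The claim is then that the multiset of mark
sequences of the shuffles of [u] and [v] depends only on the mark sequences of
[u] and of [v].

Instead of a bijection, the proof counts with weights that are multiplicative
under shuffling. Call [G] a shuffle character if the sum of [G t] over the
shuffles [t] of [u] and [v] is [G u * G v].
- The indicator of the increasing words is a character, because exactly one
  shuffle of two increasing words is increasing; likewise for the decreasing
  words and for the empty word ([sorted_character], [is_nil_character]).
- Characters are closed under the convolution that sums [G w1 * H w2] over the
  factorizations [w = w1 w2], because cutting a shuffle of [u] and [v] in two
  amounts to cutting [u] and [v] and shuffling the pieces ([shuffle_sum_conv]).
  So the number of ways to cut a word into a decreasing part followed by an
  increasing one is a character, also when one of the parts is required to be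
  empty: the decreasing one if descents are counted or if a 0 precedes, the
  increasing one if a 0 follows. It is nonzero exactly for the valley-shaped
  words, which are the words without marks, and it depends only on the length
  and on the absence of marks ([valley_marks]).
- Cutting a word into blocks of prescribed lengths and multiplying the valley
  counts of the blocks gives the tests [valley_test]. The sum of a test over
  the shuffles of [u] and [v] is a sum over compatible cuts of [u] and [v] of
  products of valley counts, so it depends only on the marks of [u] and [v]
  ([eq_shuffle_sum_valley_test]).

It remains to recover the multiset of mark sequences from the sums of the
tests. Cutting [w] after each of its marked letters gives a test which is
nonzero at [w], and at no word whose mark sequence is lexicographically larger
([valley_test_bounds_marks]); a triangular system of this kind has a unique
solution ([perm_of_triangular_sums]). *)

Implicit Types (u v w t : seq nat) (G H : seq nat -> nat) (d l r : bool).

(** * Shuffles of words *)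

Fixpoint shuffles u : seq nat -> seq (seq nat) :=
  if u is x :: u' then
    fix shuffles_u v := if v is y :: v' then
      [seq x :: t | t <- shuffles u' v] ++ [seq y :: t | t <- shuffles_u v']
    else [:: u]
  else fun v => [:: v].

Lemma shuffles0s v : shuffles [::] v = [:: v].
Proof. by []. Qed.

Lemma shuffless0 u : shuffles u [::] = [:: u].
Proof. by case: u. Qed.

Lemma shuffles_cons x u y v : shuffles (x :: u) (y :: v) =
  [seq x :: t | t <- shuffles u (y :: v)] ++
  [seq y :: t | t <- shuffles (x :: u) v].
Proof. by []. Qed.

Lemma shuffles_ind (P : seq nat -> seq nat -> Prop) :
  (forall v, P [::] v) -> (forall u, P u [::]) ->
  (forall x u y v, P u (y :: v) -> P (x :: u) v -> P (x :: u) (y :: v)) ->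
  forall u v, P u v.
Proof.
move=> P0 P1 PS; elim=> [|x u IHu] v; first exact: P0.
by elim: v => [|y v IHv]; [exact: P1 | exact: PS].
Qed.

Lemma perm_shuffles u v t : t \in shuffles u v -> perm_eq t (u ++ v).
Proof.
move: u v t; apply: shuffles_ind => [v|u|x u y v IHu IHv] t.
- by rewrite shuffles0s inE => /eqP ->.
- by rewrite shuffless0 inE cats0 => /eqP ->.
rewrite shuffles_cons mem_cat => /orP[] /mapP[t' t't ->].
  by rewrite /= perm_cons IHu.
by rewrite perm_sym (perm_catCA (x :: u) [:: y] v) perm_cons perm_sym IHv.
Qed.

(** Without repeated letters, the first letter of a common superword tells
which of the two words it comes from, so the recursion misses no shuffle. *)
Lemma mem_shuffles u v t : uniq (u ++ v) ->
  (t \in shuffles u v) = [&& perm_eq t (u ++ v), subseq u t & subseq v t].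
Proof.
move: u v t; apply: shuffles_ind => [v|u|x u y v IHu IHv] t Uuv.
- rewrite shuffles0s inE sub0seq /=; apply/eqP/andP => [->|[tv vt]].
    by rewrite perm_refl subseq_refl.
  by apply/esym/eqP; rewrite -(size_subseq_leqif vt) (perm_size tv).
- rewrite shuffless0 inE sub0seq cats0 andbT.
  apply/eqP/andP => [->|[tu ut]]; first by rewrite perm_refl subseq_refl.
  by apply/esym/eqP; rewrite -(size_subseq_leqif ut) (perm_size tu).
have Uu : uniq (u ++ y :: v) by case/andP: Uuv.
have permy s : perm_eq s (x :: u ++ y :: v) = perm_eq s (y :: x :: u ++ v).
  by rewrite perm_sym (perm_catCA (x :: u) [:: y] v) perm_sym.
have Uv : uniq ((x :: u) ++ v).
  have /perm_uniq E : perm_eq (x :: u ++ y :: v) (y :: x :: u ++ v).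
    by rewrite -permy.
  by move: Uuv; rewrite E => /andP[].
have nxy : x != y.
  by apply: contraL Uuv => /eqP ->; rewrite /= mem_cat mem_head orbT.
rewrite shuffles_cons mem_cat; case: t => [|z t].
  by rewrite /= andbF; apply/negP => /orP[] /mapP[].
have memcons (a : nat) s :
    (z :: t \in [seq a :: i | i <- s]) = (z == a) && (t \in s).
  apply/mapP/andP => [[i si [-> ->]]|[/eqP -> ts]]; first by rewrite eqxx.
  by exists t.
rewrite !memcons IHu // IHv //.
have [-> | nzx] := eqVneq z x.
  by rewrite (negPf nxy) orbF /= perm_cons eqxx eq_sym (negPf nxy).
have [-> | nzy] := eqVneq z y.
  by rewrite [in RHS]permy perm_cons /= eqxx (negPf nxy).
apply/esym/negbTE/negP => /and3P[tuv].
have := perm_uniq tuv; rewrite Uuv /= => /andP[nzt _].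
rewrite /= !(eq_sym _ z, negPf nzx, negPf nzy) => /mem_subseq ut /mem_subseq vt.
have := perm_mem tuv z; rewrite mem_head mem_cat => /esym/orP[/ut|/vt];
  by rewrite (negPf nzt).
Qed.

Lemma shuffles_uniq u v : uniq (u ++ v) -> uniq (shuffles u v).
Proof.
move: u v; apply: shuffles_ind => [v|u|x u y v IHu IHv] Uuv.
- by [].
- by rewrite shuffless0.
have inj (a : nat) : injective (cons a) by move=> ? ? [].
rewrite shuffles_cons cat_uniq !map_inj_uniq //.
have nxy : x != y.
  by apply: contraL Uuv => /eqP ->; rewrite /= mem_cat mem_head orbT.
rewrite IHu; last by case/andP: Uuv.
rewrite IHv; last first.
  have E : perm_eq ((x :: u) ++ y :: v) (y :: x :: u ++ v).
    by rewrite (perm_catCA (x :: u) [:: y] v).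
  by move: Uuv; rewrite (perm_uniq E) => /andP[].
rewrite andbT; apply/hasPn => _ /mapP[t _ ->]; apply/mapP => -[t' _ [yx _]].
by rewrite yx eqxx in nxy.
Qed.

(** * Multiplicative functions on shuffles *)

Definition shuffle_sum G u v := \sum_(t <- shuffles u v) G t.

Lemma shuffle_sum0s G v : shuffle_sum G [::] v = G v.
Proof. by rewrite /shuffle_sum big_seq1. Qed.

Lemma shuffle_sums0 G u : shuffle_sum G u [::] = G u.
Proof. by rewrite /shuffle_sum shuffless0 big_seq1. Qed.

Lemma shuffle_sum_cons G x u y v : shuffle_sum G (x :: u) (y :: v) =
  shuffle_sum (fun t => G (x :: t)) u (y :: v) +
  shuffle_sum (fun t => G (y :: t)) (x :: u) v.
Proof. by rewrite /shuffle_sum shuffles_cons big_cat !big_map. Qed.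

Definition splits w := [seq (take i w, drop i w) | i <- iota 0 (size w).+1].

Definition conv G H w := \sum_(c <- splits w) G c.1 * H c.2.

Lemma splits_cons x w :
  splits (x :: w) = ([::], x :: w) :: [seq (x :: c.1, c.2) | c <- splits w].
Proof.
rewrite /splits -map_comp /=; do 2!congr (_ :: _).
by rewrite (iotaDl 1 1 _ : iota 2 _ = _) -map_comp.
Qed.

Lemma conv_nil G H : conv G H [::] = G [::] * H [::].
Proof. by rewrite /conv big_seq1. Qed.

Lemma conv_cons G H x w :
  conv G H (x :: w) = G [::] * H (x :: w) + conv (fun t => G (x :: t)) H w.
Proof. by rewrite /conv splits_cons big_cons big_map. Qed.

Lemma shuffle_sumD G H u v :
  shuffle_sum (fun t => G t + H t) u v = shuffle_sum G u v + shuffle_sum H u v.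
Proof. exact: big_split. Qed.

Lemma shuffle_sumZ (c : nat) H u v :
  shuffle_sum (fun t => c * H t) u v = c * shuffle_sum H u v.
Proof. by rewrite /shuffle_sum big_distrr. Qed.

Lemma eq_shuffle_sum G H u v :
  {in shuffles u v, G =1 H} -> shuffle_sum G u v = shuffle_sum H u v.
Proof. exact: eq_big_seq. Qed.

(** The compatibility of deconcatenation with shuffling: a factorization of a
shuffle of [u] and [v] is the same as a factorization of each of [u] and [v],
together with a shuffle of the two prefixes and a shuffle of the two suffixes.
The function [G] varies in the induction, as the first letter of the prefix is
absorbed into it. *)
Lemma shuffle_sum_conv G H u v : shuffle_sum (conv G H) u v =
  \sum_(c <- splits u) \sum_(e <- splits v)
     shuffle_sum G c.1 e.1 * shuffle_sum H c.2 e.2.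
Proof.
move: u v G; apply: shuffles_ind => [v|u|x u y v IHu IHv] G.
- rewrite shuffle_sum0s big_seq1; apply: eq_bigr => e _.
  by rewrite !shuffle_sum0s.
- rewrite shuffle_sums0; apply: eq_bigr => c _.
  by rewrite big_seq1 !shuffle_sums0.
rewrite shuffle_sum_cons.
under eq_shuffle_sum => t _ do rewrite conv_cons.
under [X in _ + X]eq_shuffle_sum => t _ do rewrite conv_cons.
rewrite !shuffle_sumD !shuffle_sumZ IHu IHv addnACA -mulnDr -shuffle_sum_cons.
rewrite !(splits_cons y) !(splits_cons x).
move: (splits u) (splits v) => su sv; rewrite !big_cons !big_map /=.
rewrite shuffle_sum0s -addnA; congr (_ + _).
rewrite addnCA; congr (_ + _).
  by apply: eq_bigr => e _; rewrite !shuffle_sum0s.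
rewrite -big_split /=; apply: eq_bigr => c _.
rewrite !big_cons !big_map /= !shuffle_sums0 -addnA; congr (_ + _).
rewrite -big_split /=; apply: eq_bigr => e _.
by rewrite shuffle_sum_cons mulnDl.
Qed.

Definition shuffle_character G :=
  forall u v, uniq (u ++ v) -> shuffle_sum G u v = G u * G v.

Lemma uniq_splits u v c e : uniq (u ++ v) -> c \in splits u -> e \in splits v ->
  uniq (c.1 ++ e.1) && uniq (c.2 ++ e.2).
Proof.
move=> Uuv /mapP[i _ ->] /mapP[j _ ->] /=; apply/andP; split.
  apply: (subseq_uniq _ Uuv); apply: cat_subseq; exact: take_subseq.
apply: (subseq_uniq _ Uuv); apply: cat_subseq; exact: drop_subseq.
Qed.

Lemma conv_character G H :
  shuffle_character G -> shuffle_character H -> shuffle_character (conv G H).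
Proof.
move=> chG chH u v Uuv; rewrite shuffle_sum_conv big_distrlr /=.
apply: eq_big_seq => c cu; apply: eq_big_seq => e ev.
have /andP[U1 U2] := uniq_splits Uuv cu ev.
by rewrite chG // chH // mulnACA.
Qed.

Definition is_nil w : nat := nilp w.

Lemma is_nil_character : shuffle_character is_nil.
Proof.
apply: shuffles_ind => [v|u|x u y v _ _] _.
- by rewrite shuffle_sum0s mul1n.
- by rewrite shuffle_sums0 muln1.
by rewrite shuffle_sum_cons /shuffle_sum !big1.
Qed.

(** Of the two candidates for the first letter of a sorted shuffle, only the
[e]-smaller one is possible; hence exactly one shuffle of two sorted words is
sorted, and none if one of the words is not sorted. *)
Lemma sorted_character (e : rel nat) : transitive e ->
  (forall x y, x != y -> e x y = ~~ e y x) ->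
  shuffle_character (fun w => sorted e w).
Proof.
move=> e_tr e_tot; apply: shuffles_ind => [v|u|x u y v IHu IHv] Uuv.
- by rewrite shuffle_sum0s mul1n.
- by rewrite shuffle_sums0 muln1.
have nxy : x != y.
  by apply: contraL Uuv => /eqP ->; rewrite /= mem_cat mem_head orbT.
have path_sum a u1 v1 : shuffle_sum (fun t => sorted e (a :: t)) u1 v1 =
    all (e a) (u1 ++ v1) * shuffle_sum (fun t => sorted e t) u1 v1.
  rewrite -shuffle_sumZ; apply: eq_shuffle_sum => t tuv /=.
  by rewrite path_sortedE // (perm_all _ (perm_shuffles tuv)) mulnb.
rewrite shuffle_sum_cons !path_sum IHu; last by case/andP: Uuv.
rewrite IHv; last first.
  have E : perm_eq ((x :: u) ++ y :: v) (y :: x :: u ++ v).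
    by rewrite (perm_catCA (x :: u) [:: y] v).
  by move: Uuv; rewrite (perm_uniq E) => /andP[].
rewrite !all_cat /= !path_sortedE // (e_tot _ _ nxy) !mulnb.
have e_all a b s : e a b -> all (e b) s -> all (e a) s.
  by move=> ab /allP bs; apply/allP => z /bs; apply: e_tr.
case eyx: (e y x) => /=.
  rewrite andbF /= add0n; congr (nat_of_bool _).
  have := e_all _ _ u eyx.
  by case: (all (e x) u) => /= [->|]; rewrite ?andbF //= andbCA.
have {eyx}exy : e x y by rewrite e_tot ?eyx.
rewrite addn0; congr (nat_of_bool _); have := e_all _ _ v exy.
by case: (all (e y) v) => /= [->|]; rewrite ?andbF //= andbT andbA.
Qed.

(** * Marks and valley-shaped words *)

(** The number of ways to write a word as a decreasing word followed by an
increasing one. The flag [l] (resp. [r]) stands for a 0 before (resp. after)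
the word: nothing can decrease from, nor increase to, that 0, which forces the
decreasing (resp. increasing) part to be empty. *)
Definition valley l r : seq nat -> nat :=
  conv (if l then is_nil else fun w => sorted gtn w)
       (if r then is_nil else fun w => sorted ltn w).

Lemma valley_character l r : shuffle_character (valley l r).
Proof.
apply: conv_character; [case: l | case: r]; try exact: is_nil_character.
  apply: sorted_character => [y x z xy yz | x y nxy /=].
    exact: ltn_trans yz xy.
  by case: ltngtP nxy.
apply: sorted_character => [|x y nxy /=]; first exact: ltn_trans.
by case: ltngtP nxy.
Qed.

(** The state [l] says whether the current letter may be marked. For [d = false]
it records that the last step went up (initially, that a 0 precedes the word),
so that the marked letters are the peaks. For [d = true] it stays true if it is
true at the start, and the marked letters are the descent tops. The last step
of the word goes down exactly when a 0 follows, that is when [r] holds. *)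
Fixpoint marks d l r w : seq bool :=
  if w is x :: w' then
    let up := if w' is y :: _ then x < y else ~~ r in
    (l && ~~ up) :: marks d (up || d) r w'
  else [::].

Lemma size_marks d l r w : size (marks d l r w) = size w.
Proof. by elim: w l => //= x w IHw l; rewrite IHw. Qed.

(** Between two zeros, a nonempty word has a maximal letter, which is a peak. *)
Lemma has_marks_true d x w : has id (marks d true true (x :: w)).
Proof.
elim: w x => [|y w IHw] x //=.
by case: ltnP => //= _; apply: IHw.
Qed.

Lemma conv_is_nil H w : conv is_nil H w = H w.
Proof.
case: w => [|x w]; first by rewrite conv_nil mul1n.
by rewrite conv_cons mul1n /conv big1 ?addn0.
Qed.

Lemma sorted_marks d x w : uniq (x :: w) ->
  sorted ltn (x :: w) = ~~ has id (marks d true false (x :: w)).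
Proof.
elim: w x => [|y w IHw] x //= /andP[_ Uyw].
by case: ltnP => //= _; apply: IHw.
Qed.

(** The lowest letter of a valley-shaped word may be put in the decreasing or in
the increasing part, unless one of them has to be empty: hence the factor
[2 - l - r]. When [l = r = true] that factor vanishes, as does the other one by
[has_marks_true]. Since a word without descents has neither descent tops nor
peaks once the initial state is up, [d] may be arbitrary if [l] holds. *)
Lemma valley_marks d l r w : d ==> l -> uniq w ->
  valley l r w = (if nilp w then 1 else 2 - l - r) * ~~ has id (marks d l r w).
Proof.
case: w => [_ _|x w]; first by rewrite /valley conv_nil; case: l; case: r.
move=> dl Uw; rewrite /valley [nilp _]/=.
case: l dl => [_|].
  rewrite conv_is_nil; case: r => //.
  by rewrite (sorted_marks d Uw) mul1n.
case: d => // _.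
elim: w x Uw => [|y w IHw] x Uw.
  by rewrite conv_cons conv_nil; case: r.
have Uyw : uniq (y :: w) by case/andP: Uw.
have nxy : x != y by move: Uw; rewrite /= inE negb_or => /andP[/andP[]].
rewrite conv_cons conv_cons mul1n.
have -> : conv (fun t => sorted gtn [:: x, y & t])
    (if r then is_nil else fun w => sorted ltn w) w =
  (y < x) * conv (fun t => sorted gtn (y :: t))
    (if r then is_nil else fun w => sorted ltn w) w.
  by rewrite /conv big_distrr /=; apply: eq_bigr => c _; rewrite mulnA mulnb.
have {IHw} := IHw _ Uyw; rewrite conv_cons /=.
case: (ltngtP x y) nxy => //= [lxy|lyx] _.
  rewrite mul0n addn0 => _; case: r => /=.
    by have := has_marks_true false y w; rewrite /= => ->.
  rewrite lxy mul1n /= -[path _ _ _]/(sorted ltn (y :: w)).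
  by rewrite (sorted_marks false Uyw) /=; case: (~~ _).
move=> <-; rewrite !mul1n; case: r => //=.
by rewrite ltnNge (ltnW lyx).
Qed.

Lemma valley_gt0 d l r w : d ==> l -> uniq w ->
  (0 < valley l r w) = ~~ has id (marks d l r w).
Proof.
move=> dl Uw; rewrite (valley_marks _ dl Uw) muln_gt0 lt0b.
case: w {Uw} => [|x w] //; case: l dl => _; case: r => //.
by rewrite has_marks_true.
Qed.

Lemma eq_valley d l r u v : d ==> l -> uniq u -> uniq v ->
  marks d l r u = marks d l r v -> valley l r u = valley l r v.
Proof.
move=> dl Uu Uv uv; have := congr1 size uv; rewrite !size_marks => suv.
by rewrite !(valley_marks r dl) // uv /nilp suv.
Qed.

Lemma marks_take d l r w i : i < size w ->
  marks d l false (take i.+1 w) = rcons (take i (marks d l r w)) false.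
Proof.
elim: w l i => [|x [|y w] IHw] l [|i] //=; try by rewrite andbF.
by move=> iw; rewrite -(IHw _ i).
Qed.

(** After a cut, the first letter is marked only if descents are considered: it
has lost the letter before it. *)
Lemma marks_drop d l r w i : d ==> l -> marks d d r (drop i w) =
  if drop i (marks d l r w) is b :: s then d && b :: s else [::].
Proof.
elim: w l i => [|x w IHw] l [|i] //= dl; first by case: d dl {IHw} => //= ->.
by apply: IHw; rewrite implybE orbCA orNb orbT.
Qed.

(** Two consecutive letters cannot both be peaks, so no mark is lost when cutting
right after a marked letter. *)
Lemma marks_drop_marked d l r w i : nth false (marks d l r w) i ->
  marks d d r (drop i.+1 w) = drop i.+1 (marks d l r w).
Proof.
elim: w l i => [|x w IHw] l [|i] //=; last exact: IHw.
by rewrite !drop0 => /andP[_ /negbTE ->].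
Qed.

(** * Tests and their sums over shuffles *)

(** Cut a word into blocks of the lengths listed in [a] and a last block of
arbitrary length, and multiply the valley counts. The flags [l] and [r] apply to
the first and the last block; at the beginning of the later blocks the state is
[d], the value that makes descents, respectively peaks, start afresh. *)
Fixpoint valley_test d l r (a : seq nat) : seq nat -> nat :=
  if a is b :: a' then
    conv (fun w => (size w == b) * valley l false w) (valley_test d d r a')
  else valley l r.

Lemma shuffle_sum_sized_character G b u v :
  shuffle_character G -> uniq (u ++ v) ->
  shuffle_sum (fun w => (size w == b) * G w) u v =
  (size u + size v == b) * (G u * G v).
Proof.
move=> chG Uuv; rewrite -chG // -shuffle_sumZ; apply: eq_shuffle_sum => t tuv.
by rewrite (perm_size (perm_shuffles tuv)) size_cat.
Qed.

(** By [shuffle_sum_conv] the sum is a sum over pairs of cuts, and each term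
involves only the marks of the pieces, which are determined by the marks of the
whole words. *)
Lemma eq_shuffle_sum_valley_test d l r a u v u' v' : d ==> l ->
  uniq (u ++ v) -> uniq (u' ++ v') ->
  marks d l r u = marks d l r u' -> marks d l r v = marks d l r v' ->
  shuffle_sum (valley_test d l r a) u v = shuffle_sum (valley_test d l r a) u' v'.
Proof.
have eq_size l0 w w' : marks d l0 r w = marks d l0 r w' -> size w = size w'.
  by move/(congr1 size); rewrite !size_marks.
elim: a l u v u' v' => [|b a IHa] l u v u' v' dl U U' eu ev.
  rewrite !valley_character //; move: U U'; rewrite !cat_uniq.
  move=> /and3P[Uu _ Uv] /and3P[Uu' _ Uv'].
  by rewrite (eq_valley dl Uu Uu' eu) (eq_valley dl Uv Uv' ev).
have su := eq_size _ _ _ eu; have sv := eq_size _ _ _ ev.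
rewrite !shuffle_sum_conv /splits -su -sv !big_map.
have eq_take w w' i : marks d l r w = marks d l r w' -> i <= size w ->
    marks d l false (take i w) = marks d l false (take i w').
  case: i => [|i] eww' iw; first by rewrite !take0.
  by rewrite !(marks_take d l r) ?eww' // -(eq_size _ _ _ eww').
apply: eq_big_seq => i; rewrite mem_iota add0n ltnS => /andP[_ iu].
rewrite !big_map; apply: eq_big_seq => j; rewrite mem_iota add0n ltnS => /andP[_ jv].
have Ut w w' : uniq (w ++ w') -> uniq (take i w ++ take j w').
  move=> Uw; apply: subseq_uniq Uw; apply: cat_subseq; exact: take_subseq.
have Ud w w' : uniq (w ++ w') -> uniq (drop i w ++ drop j w').
  move=> Uw; apply: subseq_uniq Uw; apply: cat_subseq; exact: drop_subseq.
congr (_ * _); last first.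
  by apply: IHa; rewrite ?implybb ?Ud // !(marks_drop r _ _ dl) ?eu ?ev.
have chV := @valley_character l false.
rewrite !shuffle_sum_sized_character ?Ut //; congr (_ * _).
  by rewrite !size_take -su -sv.
have := Ut _ _ U; have := Ut _ _ U'; rewrite !cat_uniq.
move=> /and3P[Uu' _ Uv'] /and3P[Uu _ Uv].
rewrite (eq_valley dl Uu Uu' (eq_take _ _ _ eu iu)).
by rewrite (eq_valley dl Uv Uv' (eq_take _ _ _ ev jv)).
Qed.

(** The case of shuffles with the empty word. *)
Lemma eq_valley_test d l r a u v : d ==> l -> uniq u -> uniq v ->
  marks d l r u = marks d l r v -> valley_test d l r a u = valley_test d l r a v.
Proof.
move=> dl Uu Uv uv; rewrite -(shuffle_sums0 _ u) -(shuffle_sums0 _ v).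
by apply: eq_shuffle_sum_valley_test; rewrite ?cats0.
Qed.

Lemma conv_sized G H b w : b <= size w ->
  conv (fun t => (size t == b) * G t) H w = G (take b w) * H (drop b w).
Proof.
move=> bw; rewrite /conv /splits big_map.
have s_uniq := iota_uniq 0 (size w).+1.
have s_mem i : (i \in iota 0 (size w).+1) = (i <= size w).
  by rewrite mem_iota.
rewrite (bigD1_seq b) ?s_mem //; move: (iota 0 _) s_mem {s_uniq} => s s_mem /=.
rewrite size_takel // eqxx mul1n big_seq_cond big1 ?addn0 // => i.
by rewrite s_mem => /andP[iw /negPf nib]; rewrite size_takel ?nib.
Qed.

(** * Triangularity of the tests *)

(** On sequences of equal length, the value of the binary expansion realizes the
lexicographic order. *)
Fixpoint binary (s : seq bool) : nat :=
  if s is b :: s' then b * 2 ^ size s' + binary s' else 0.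

Lemma binary_lt s : binary s < 2 ^ size s.
Proof. by elim: s => //= b s IHs; rewrite expnS; case: b; lia. Qed.

Lemma binary_inj (s t : seq bool) : size s = size t -> binary s = binary t -> s = t.
Proof.
elim: s t => [|b s IHs] [|c t] //= [st]; rewrite st => E.
have := binary_lt s; have := binary_lt t; rewrite st => lt ls.
have bc : b = c by case: b c E => -[] //; lia.
by rewrite bc in E *; rewrite (IHs t) //; apply: addnI E.
Qed.

Lemma binary_catl (s t : seq bool) : ~~ has id s -> binary (s ++ t) = binary t.
Proof. by elim: s => //= -[] //= s IHs /IHs ->. Qed.

(** If [s] vanishes before the first true entry of [t], then either [s] has a
true entry there too and the comparison passes to the remainders, or [s] is
lexicographically smaller. *)
Lemma leq_binary_find (s t : seq bool) : size s = size t -> has id t ->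
  ~~ has id (take (find id t) s) ->
  (nth false s (find id t) ->
     binary (drop (find id t).+1 s) <= binary (drop (find id t).+1 t)) ->
  binary s <= binary t.
Proof.
move=> st ht; set i := find id t => s0 le_drop.
have it : i < size t by rewrite -has_find.
rewrite -(cat_take_drop i s) -(cat_take_drop i t) !binary_catl //; last first.
  by rewrite has_take_leq ?ltnn // ltnW.
have is_ : i < size s by rewrite st.
rewrite (drop_nth false it) (drop_nth false is_) /= !size_drop st.
rewrite (nth_find false ht : nth false t i = true) mul1n.
case: nth le_drop => [|_]; first by rewrite mul1n leq_add2l; apply.
rewrite mul0n add0n; apply: ltnW; apply: leq_trans (leq_addr _ _).
by have := binary_lt (drop i.+1 s); rewrite size_drop st.
Qed.

(** The test cuts [w] after each of its marked letters, so that no mark of [w]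
survives inside a block. If it does not vanish at [w'], then [w'] has no mark
before the first mark [i] of [w]. If [i] is not marked in [w'], its mark sequence
is smaller; if it is, both mark sequences restart afresh after [i] and the
argument repeats. *)
Lemma valley_test_bounds_marks d l r w : d ==> l -> uniq w ->
  exists2 a, 0 < valley_test d l r a w &
    forall w', uniq w' -> size w' = size w -> 0 < valley_test d l r a w' ->
      binary (marks d l r w') <= binary (marks d l r w).
Proof.
have [n] := ubnP (size w); elim: n l w => // n IHn l w le_wn dl Uw.
have [hw|nhw] := boolP (has id (marks d l r w)); last first.
  exists [::] => [|w' Uw' _]; first by rewrite /= (valley_gt0 _ dl).
  rewrite /= (valley_gt0 _ dl) // => nhw'.
  by rewrite -[marks d l r w']cats0 binary_catl.
(* The first block ends with the first marked letter, of index [i]. *)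
set i := find id (marks d l r w).
have iw : i < size w by rewrite -(size_marks d l r) -has_find.
have [|||a a_w aP] := IHn d (drop i.+1 w).
- by rewrite size_drop; lia.
- exact: implybb.
- exact: drop_uniq.
have free w' : uniq w' -> size w' = size w ->
    (0 < valley l false (take i.+1 w')) = ~~ has id (take i (marks d l r w')).
  move=> Uw' sw'; rewrite (valley_gt0 _ dl) ?take_uniq //.
  by rewrite (marks_take _ _ r) ?sw' // -cats1 has_cat orbF.
exists (i.+1 :: a) => [|w' Uw' sw'] /=.
  rewrite conv_sized // muln_gt0 a_w andbT free //.
  by rewrite has_take_leq ?ltnn ?size_marks ?(ltnW iw).
rewrite conv_sized ?sw' // muln_gt0 free // => /andP[w'0 a_w'].
apply: leq_binary_find; rewrite ?size_marks // -/i => w'i.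
have wi : nth false (marks d l r w) i by exact: (nth_find false hw).
rewrite -(marks_drop_marked w'i) -(marks_drop_marked wi).
by apply: aP; rewrite ?drop_uniq // !size_drop sw'.
Qed.

Lemma sum_gt0_exists (T : eqType) (f : T -> nat) (A : seq T) :
  (0 < \sum_(x <- A) f x) = has (fun x => 0 < f x) A.
Proof.
elim: A => [|x A IHA]; first by rewrite big_nil.
by rewrite big_cons addn_gt0 IHA.
Qed.

(** A triangular system of sums determines the multiset of keys: take [x] with
minimal [mu] in the two families. The test of [x] is positive only at elements
with the key of [x], and its two sums are equal and positive, so this key occurs
in both families; remove one occurrence from each and repeat. *)
Lemma perm_of_triangular_sums (T K : eqType) (I : Type) (N : I -> T -> nat)
    (key : T -> K) (mu : T -> nat) (A B : seq T) :
  {in A ++ B &, forall x y, key x = key y -> forall a, N a x = N a y} ->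
  {in A ++ B, forall x, exists2 a, 0 < N a x &
     {in A ++ B, forall y, 0 < N a y -> key y = key x \/ mu y < mu x}} ->
  (forall a, \sum_(x <- A) N a x = \sum_(x <- B) N a x) ->
  perm_eq (map key A) (map key B).
Proof.
have [n] := ubnP (size A); elim: n A B => // n IHn A B le_An Nkey Ntri Nsum.
have [/eqP|] := boolP (A ++ B == [::]).
  by case: A {le_An Nkey Ntri Nsum} => //= ->.
move=> AB0; have mu_ex : exists m, has (fun x => mu x == m) (A ++ B).
  by case: (A ++ B) AB0 => // x s _; exists (mu x); rewrite /= eqxx.
case: (ex_minnP mu_ex) => m /hasP[x xAB /eqP mux] m_min.
have [a Nax aP] := Ntri x xAB.
have key_x y : y \in A ++ B -> 0 < N a y -> key y = key x.
  move=> yAB /(aP y yAB)[//|]; rewrite mux ltnNge m_min //.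
  by apply/hasP; exists y.
have hAB : has (fun y => 0 < N a y) A && has (fun y => 0 < N a y) B.
  rewrite -!sum_gt0_exists Nsum andbb; move: xAB; rewrite mem_cat.
  case/orP => xS; last by rewrite sum_gt0_exists; apply/hasP; exists x.
  by rewrite -Nsum sum_gt0_exists; apply/hasP; exists x.
case/andP: hAB => /hasP[y yA Nay] /hasP[z zB Naz].
have yAB : y \in A ++ B by rewrite mem_cat yA.
have zAB : z \in A ++ B by rewrite mem_cat zB orbT.
have kyz : key y = key z by rewrite !key_x.
have pA := perm_to_rem yA; have pB := perm_to_rem zB.
apply: (perm_trans (perm_map key pA)); rewrite perm_sym.
apply: (perm_trans (perm_map key pB)); rewrite /= kyz perm_cons perm_sym.
have sub : {subset rem y A ++ rem z B <= A ++ B}.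
  move=> t; rewrite !mem_cat => /orP[] /mem_rem ->; by rewrite ?orbT.
apply: IHn.
- by have := perm_size pA => /= sA; lia.
- by move=> s t /sub sAB /sub tAB; apply: Nkey.
- move=> s /sub/Ntri[c Ncs cP]; exists c => // t /sub; exact: cP.
move=> c; have := Nsum c; rewrite (perm_big _ pA) (perm_big _ pB) /= !big_cons.
by rewrite (Nkey y z yAB zAB kyz) => /addnI.
Qed.

Lemma perm_marks_shuffles d l r u v u' v' : d ==> l ->
  uniq (u ++ v) -> uniq (u' ++ v') ->
  marks d l r u = marks d l r u' -> marks d l r v = marks d l r v' ->
  perm_eq [seq marks d l r t | t <- shuffles u v]
          [seq marks d l r t | t <- shuffles u' v'].
Proof.
move=> dl U U' eu ev.
have szE w w' : marks d l r w = marks d l r w' -> size w = size w'.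
  by move/(congr1 size); rewrite !size_marks.
have all_t t : t \in shuffles u v ++ shuffles u' v' ->
    uniq t /\ size t = size u + size v.
  rewrite mem_cat => /orP[] /perm_shuffles tP.
    by rewrite (perm_uniq tP) (perm_size tP) size_cat.
  by rewrite (perm_uniq tP) (perm_size tP) size_cat (szE _ _ eu) (szE _ _ ev).
apply: (@perm_of_triangular_sums _ _ _ (valley_test d l r) _ (fun t => binary (marks d l r t))).
- move=> s t /all_t[Us _] /all_t[Ut _] st a; exact: eq_valley_test.
- move=> s /all_t[Us ss]; have [a a_s aP] := valley_test_bounds_marks r dl Us.
  exists a => // t /all_t[Ut st] a_t.
  have := aP t Ut; rewrite st ss => /(_ erefl a_t).
  rewrite leq_eqVlt => /orP[/eqP|]; last by right.
  by move/binary_inj; rewrite !size_marks st ss => /(_ erefl); left.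
move=> a; exact: eq_shuffle_sum_valley_test.
Qed.

(** * Statistics given by marks *)

Lemma letter_ltn_consecutive (p : permutation) i : i < size p ->
  (letter p i.+1 < letter p i.+2) = ~~ (letter p i.+2 < letter p i.+1).
Proof.
move=> ip; case: (ltngtP i.+1 (size p)) ip => // [ip _|ip _].
  suff: letter p i.+1 != letter p i.+2 by case: ltngtP.
  by rewrite /letter /= nth_uniq ?perm_uniq_word ?(ltnW ip) ?ltn_eqF.
rewrite (@letter_out p i.+2) -?ip // ltn0 letter_pos //; by rewrite -ip leqnn.
Qed.

Lemma nth_marks d l r (p : permutation) i : i < size p ->
  nth false (marks d l r p) i =
  [&& (if i == 0 then l else (letter p i < letter p i.+1) || d),
      (i.+1 < size p) || r & letter p i.+2 < letter p i.+1].
Proof.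
move=> ip.
have -> : nth false (marks d l r p) i =
  (if i == 0 then l else (letter p i < letter p i.+1) || d) &&
  ~~ (if i.+1 < size p then letter p i.+1 < letter p i.+2 else ~~ r).
  rewrite /letter; elim: (word p) i l ip => [|x w IHw] [|i] l //=.
    by case: w {IHw}.
  rewrite ltnS => iw; rewrite IHw //=; case: i iw => //=.
  by case: w {IHw}.
congr (_ && _); case: ltnP => ip'; first by rewrite letter_ltn_consecutive ?negbK.
rewrite negbK /= (@letter_out p i.+2) ?ltnS // letter_pos ?andbT //.
Qed.

Definition positions (s : seq bool) : {fset nat} :=
  [fset i in index_iota 1 (size s).+1 | nth false s i.-1]%fset.

Lemma positions_inj (s t : seq bool) : size s = size t -> positions s = positions t -> s = t.
Proof.
move=> st /fsetP E; apply: (@eq_from_nth _ false) => // i i_s.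
by have := E i.+1; rewrite !inE /= !mem_index_iota !ltnS -st i_s.
Qed.

Lemma disjoint_dom_uniq (p s : permutation) :
  (dom p `&` dom s = fset0)%fset -> uniq (p ++ s).
Proof.
move/fsetP => ps; rewrite cat_uniq !perm_uniq_word andbT /=.
apply/hasPn => x xs; apply/negP => xp.
by have := ps x; rewrite !inE xp xs.
Qed.

Lemma perm_Sh_shuffles (p s : permutation) : uniq (p ++ s) ->
  perm_eq [seq word q | q <- Sh p s] (shuffles p s).
Proof.
move=> Ups; apply: uniq_perm; last move=> t.
- by rewrite map_inj_uniq ?fset_uniq //; apply: val_inj.
- exact: shuffles_uniq.
rewrite mem_shuffles //.
have dom_perm (q : permutation) :
    (dom q == dom p `|` dom s)%fset = perm_eq q (p ++ s).
  apply/eqP/idP => [/fsetP E|qps].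
    apply: uniq_perm => // [|x]; first exact: perm_uniq_word.
    by have := E x; rewrite !inE mem_cat.
  by apply/fsetP => x; rewrite !inE (perm_mem qps) mem_cat.
have mem_Sh (q : permutation) :
    (q \in Sh p s) = [&& perm_eq q (p ++ s), subseq p q & subseq s q].
  by rewrite in_fset /= -dom_perm -mem_perms_of.
apply/mapP/and3P => [[q]|[tps pt st]].
  by rewrite mem_Sh => /and3P[? ? ?] ->.
have t_ok : uniq t && all (leq 1) t.
  rewrite (perm_uniq tps) Ups (perm_all _ tps) all_cat /=.
  by apply/andP; split; apply/allP => x; apply: perm_pos_word.
exists (Permutation t_ok) => //.
by rewrite mem_Sh /= tps pt st.
Qed.

Lemma shuffle_compatible_marks d l r (St : statistic {fset nat}) : d ==> l ->
  (forall p, St p = positions (marks d l r p)) -> shuffle_compatible St.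
Proof.
move=> dl StE p p' s s' spp' sss' /disjoint_dom_uniq Ups /disjoint_dom_uniq Ups'.
rewrite !StE => /positions_inj; rewrite !size_marks => /(_ spp') ep.
move/positions_inj; rewrite !size_marks => /(_ sss') es.
apply/eq_seq_msetP.
have StSh (q t : permutation) : uniq (q ++ t) -> perm_eq [seq St i | i <- Sh q t]
    (map positions [seq marks d l r i | i <- shuffles q t]).
  move=> Uqt; rewrite (eq_map StE).
  rewrite (map_comp positions (fun i : permutation => marks d l r i)).
  rewrite (map_comp (marks d l r) word).
  by apply: perm_map; apply: perm_map; apply: perm_Sh_shuffles.
apply: (perm_trans (StSh _ _ Ups)); rewrite perm_sym.
apply: (perm_trans (StSh _ _ Ups')); rewrite perm_sym.
by apply: perm_map; apply: perm_marks_shuffles.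
Qed.

Theorem theorem4p2 :
  [/\ shuffle_compatible Des, shuffle_compatible Pk, shuffle_compatible Lpk,
      shuffle_compatible Rpk & shuffle_compatible Epk].
Proof.
split; [apply: (@shuffle_compatible_marks true true false)
  | apply: (@shuffle_compatible_marks false false false)
  | apply: (@shuffle_compatible_marks false true false)
  | apply: (@shuffle_compatible_marks false false true)
  | apply: (@shuffle_compatible_marks false true true)] => // p;
apply/fsetP => -[|i]; rewrite !inE /= ?mem_index_iota ?size_marks //=;
(have [ip|ip] := ltnP i (size p); last by rewrite ?ltnS; lia);
(* The 0 placed in front makes the first letter an ascent top. *)
have p0 : letter p 0 < letter p 1 by rewrite letter_pos //=; lia.
all: by rewrite nth_marks // /peak_at /=; case: i ip => [|i] ip /=; lia.
Qed.
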